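(* There is a model of $\mathsf Z_2^\omega$ in which $\neg\mathsf{PIT}_o$ holds.
   Context: $\mathsf{RCA}_0^\omega$ is Kohlenbach's base theory of higher-order arithmetic in all finite types (basic arithmetic, combinators, primitive recursion, extensionality, quantifier-free induction, $\mathsf{QF\text{-}AC}^{1,0}$). $S^2_k$ is the type $2$ functional deciding the truth of $\Sigma^1_k$-formulas (with function parameters only, not functionals); $\Pi^1_k\text{-}\mathsf{CA}_0^\omega=\mathsf{RCA}_0^\omega+(\exists S^2_k)$ and $\mathsf Z_2^\omega=\bigcup_k\Pi^1_k\text{-}\mathsf{CA}_0^\omega$. $C=2^{\mathbb N}$, $\overline{f}n=\langle f(0),\dots,f(n-1)\rangle$, $[\sigma]$ = binary extensions of $\sigma$. $\mathsf{LOC}(F,G)\equiv(\forall f,g\in C)(g\in[\overline{f}G(f)]\to F(g)\le G(f))$. $\mathsf{PIT}_o$: $(\forall F,G:C\to\mathbb N)(\exists N\in\mathbb N)[\mathsf{LOC}(F,G)\to(\forall g\in C)(F(g)\le N)]$. *)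

(* Defs.v *)
From mathcomp Require Import all_boot.
Unset Implicit Arguments.
Unset Strict Implicit.
Unset Printing Implicit Defensive.

Inductive ty : Type := Zero : ty | Arr : ty -> ty -> ty.
Definition One : ty := Arr Zero Zero.
Definition Two : ty := Arr One Zero.

Definition el_of (Car : ty -> ty -> Type) (s : ty) : Type :=
  match s with Zero => nat | Arr s1 s2 => Car s1 s2 end.

Record tstruct := TStruct {
  Car : ty -> ty -> Type;
  app : forall s t : ty, Car s t -> el_of Car s -> el_of Car t
}.

Definition el (M : tstruct) (s : ty) : Type := el_of (Car M) s.
Definition ap (M : tstruct) (s t : ty) (x : el M (Arr s t)) (y : el M s) : el M t :=
  @app M s t x y.
Arguments ap {M s t} x y.

Section Semantics.
Variable M : tstruct.

Fixpoint eqT (s : ty) : el M s -> el M s -> Prop :=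
  match s as s0 return el M s0 -> el M s0 -> Prop with
  | Zero => fun x y => x = y
  | Arr s1 s2 => fun x y => forall z : el M s1, eqT s2 (ap x z) (ap y z)
  end.

Definition has_succ : Prop :=
  exists sc : el M One, forall n : nat, ap sc n = n.+1.

Definition has_Pi : Prop :=
  forall r s : ty, exists k : el M (Arr r (Arr s r)),
    forall (x : el M r) (y : el M s), eqT r (ap (ap k x) y) x.

Definition has_Sigma : Prop :=
  forall d r t : ty,
    exists c : el M (Arr (Arr d (Arr r t)) (Arr (Arr d r) (Arr d t))),
    forall (x : el M (Arr d (Arr r t))) (y : el M (Arr d r)) (z : el M d),
      eqT t (ap (ap (ap c x) y) z) (ap (ap x z) (ap y z)).

Definition has_Rec : Prop :=
  forall r : ty,
    exists R : el M (Arr Zero (Arr r (Arr (Arr r (Arr Zero r)) r))),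
    forall (y : el M r) (z : el M (Arr r (Arr Zero r))),
      eqT r (ap (ap (ap R (0 : el M Zero)) y) z) y /\
      forall x : nat,
        eqT r (ap (ap (ap R (x.+1 : el M Zero)) y) z)
              (ap (ap z (ap (ap (ap R (x : el M Zero)) y) z)) (x : el M Zero)).

Definition ext_ax : Prop :=
  forall (s t : ty) (F : el M (Arr s t)) (x y : el M s),
    eqT s x y -> eqT t (ap F x) (ap F y).

(* Terms with free variables f^1 and n^0 and parameters from the model
   (parameters include the interpretations of all constants). *)
Inductive tm : ty -> Type :=
| Par : forall s : ty, el M s -> tm s
| Vf : tm One
| Vn : tm Zero
| App : forall s t : ty, tm (Arr s t) -> tm s -> tm t.

Fixpoint ev (s : ty) (u : tm s) (f : el M One) (n : nat) : el M s :=
  match u in tm s0 return el M s0 with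
  | Par _ x => x
  | Vf => f
  | Vn => (n : el M Zero)
  | App _ _ u1 u2 => ap (ev _ u1 f n) (ev _ u2 f n)
  end.

Inductive qf : Type :=
| QEq : tm Zero -> tm Zero -> qf
| QBot : qf
| QNeg : qf -> qf
| QAnd : qf -> qf -> qf
| QOr : qf -> qf -> qf
| QImp : qf -> qf -> qf.

Fixpoint qsat (A : qf) (f : el M One) (n : nat) : Prop :=
  match A with
  | QEq u v => (ev Zero u f n : nat) = (ev Zero v f n : nat)
  | QBot => False
  | QNeg B => ~ qsat B f n
  | QAnd B C => qsat B f n /\ qsat C f n
  | QOr B C => qsat B f n \/ qsat C f n
  | QImp B C => qsat B f n -> qsat C f n
  end.

Definition qfac10 : Prop :=
  forall A : qf,
    (forall f : el M One, exists n : nat, qsat A f n) ->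
    exists Y : el M Two, forall f : el M One, qsat A f (ap Y f : nat).

(* RCA_0^omega holds in the omega-structure M.  Basic arithmetic and
   quantifier-free induction hold automatically since type 0 is nat. *)
Definition RCA0w : Prop :=
  has_succ /\ has_Pi /\ has_Sigma /\ has_Rec /\ ext_ax /\ qfac10.

Definition cpair (a b : nat) : nat := (a + b) * (a + b).+1 %/ 2 + b.
Fixpoint code (s : seq nat) : nat :=
  match s with [::] => 0 | x :: s' => (cpair x (code s')).+1 end.

Definition bar (g : el M One) (n : nat) : seq nat :=
  [seq (ap g (i : el M Zero) : nat) | i <- iota 0 n].

(* Kleene normal form:  (exists g1)(forall g2)...(Q gk)(Q' n)
   f(\bar g1 n * ... * \bar gk n) = 0,  Q' dual to Q. *)
Fixpoint nf (f : el M One) (k : nat) (ex : bool) (gs : seq (el M One)) : Prop :=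
  match k with
  | 0 =>
      let P := fun n : nat =>
        (ap f (code (flatten [seq bar g n | g <- gs]) : el M Zero) : nat) = 0 in
      if ex then exists n, P n else forall n, P n
  | k'.+1 =>
      if ex then exists g : el M One, nf f k' (~~ ex) (rcons gs g)
      else forall g : el M One, nf f k' (~~ ex) (rcons gs g)
  end.

Definition sigma1k (f : el M One) (k : nat) : Prop := nf f k true [::].

Definition has_Sk (k : nat) : Prop :=
  exists S : el M Two,
    (forall f : el M One, (ap S f : nat) <= 1) /\
    (forall f : el M One, sigma1k f k <-> (ap S f : nat) = 0).

(* Z_2^omega = union over k >= 1 of Pi^1_k-CA_0^omega *)
Definition Z2w : Prop := RCA0w /\ forall k : nat, 0 < k -> has_Sk k.

Definition inC (f : el M One) : Prop := forall i : nat, (ap f (i : el M Zero) : nat) <= 1.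

Definition incyl (g f : el M One) (n : nat) : Prop :=
  forall i : nat, i < n -> (ap g (i : el M Zero) : nat) = (ap f (i : el M Zero) : nat).

Definition LOC (F G : el M Two) : Prop :=
  forall f g : el M One, inC f -> inC g ->
    incyl g f (ap G f : nat) -> (ap F g : nat) <= (ap G f : nat).

Definition PITo : Prop :=
  forall F G : el M Two, exists N : nat,
    LOC F G -> forall g : el M One, inC g -> (ap F g : nat) <= N.

End Semantics.

(* Main.v *)
Require Import Defs.
From mathcomp Require Import all_boot.
From mathcomp Require Import boolp.

(** The model consists of the functionals denoted by closed terms in the full
    type structure over [nat].  The terms are built from combinators,
    recursors, Skolem functions for second-order formulas, type-one constants
    [x_n] and two oracles [F], [G] of type two.  The Skolem functions make the
    type-one part [A] second-order elementary in the full structure, so [S_k]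
    restricted to [A] is correct.

    The oracles are built by forcing with partial functions.  Evaluating a term
    needs only countably many oracle queries, and an infinite set of values can
    be split into countably many infinite ones, so [G] can always be extended
    injectively while deciding a term.  At stage [n] all terms in
    [x_0, ..., x_(n-1)] are decided; since [G] is injective on the functions
    [f] queried so far, diagonalization gives a binary [x_n] with
    [x_n(m) <> f(m)] whenever [G f = m + 1].  Thus [x_n] lies outside all the
    neighbourhoods [[\overline{f} G(f)]] so far.  Put [F(x_n) = n], let [F] be
    [0] elsewhere, and let all later values of [G] exceed [n]: then [LOC(F, G)]
    holds on [A] although [F] is unbounded. *)

(** * Terms over the full type structure *)

Fixpoint full (s : ty) : Type :=
  match s with Zero => nat | Arr s1 s2 => full s1 -> full s2 end.

Local Notation fn := (nat -> nat).

(* The two components are the values of [F] and [G]. *)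
Definition oracle := fn -> nat * nat.

Inductive term : ty -> Type :=
| TNum (n : nat) : term Zero
| TK (r s : ty) : term (Arr r (Arr s r))
| TS (d r t : ty) : term (Arr (Arr d (Arr r t)) (Arr (Arr d r) (Arr d t)))
| TR (r : ty) : term (Arr Zero (Arr r (Arr (Arr r (Arr Zero r)) r)))
| TPhi (k : nat) : term (Arr (Arr Zero One) One)
| TX (i : nat) : term One
| TF : term Two
| TG : term Two
| TApp (s t : ty) (u : term (Arr s t)) (v : term s) : term t.

Arguments TApp {s t} u v.

Definition recf (r : ty) (n : nat) (y : full r) (z : full r -> nat -> full r) :
  full r := nat_rect (fun=> full r) y (fun m v => z v m) n.

Fixpoint eval (Phi : nat -> (nat -> fn) -> fn) (x : nat -> fn) (H : oracle)
    (s : ty) (u : term s) : full s :=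
  match u in term s return full s with
  | TNum n => n
  | TK _ _ => fun a _ => a
  | TS _ _ _ => fun a b c => a c (b c)
  | TR r => fun n y z => recf r n y z
  | TPhi k => Phi k
  | TX i => x i
  | TF => fun f => (H f).1
  | TG => fun f => (H f).2
  | TApp _ _ u v => (eval Phi x H _ u) (eval Phi x H _ v)
  end.
Arguments eval Phi x H {s} u.

(** * Countability of the terms *)

Lemma ty_eq_dec (s t : ty) : {s = t} + {s <> t}.
Proof. decide equality. Defined.

Local Notation tree := (GenTree.tree nat).

Fixpoint ty_tree (s : ty) : tree :=
  match s with
  | Zero => GenTree.Leaf 0
  | Arr s t => GenTree.Node 0 [:: ty_tree s; ty_tree t]
  end.

Fixpoint tree_ty (t : tree) : ty :=
  if t is GenTree.Node _ [:: a; b] then Arr (tree_ty a) (tree_ty b) else Zero.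

Lemma ty_treeK : cancel ty_tree tree_ty.
Proof. by elim=> //= s -> t ->. Qed.

Fixpoint term_tree (s : ty) (u : term s) : tree :=
  match u with
  | TNum n => GenTree.Node 0 [:: GenTree.Leaf n]
  | TK r s => GenTree.Node 1 [:: ty_tree r; ty_tree s]
  | TS d r t => GenTree.Node 2 [:: ty_tree d; ty_tree r; ty_tree t]
  | TR r => GenTree.Node 3 [:: ty_tree r]
  | TPhi k => GenTree.Node 4 [:: GenTree.Leaf k]
  | TX i => GenTree.Node 5 [:: GenTree.Leaf i]
  | TF => GenTree.Node 6 [::]
  | TG => GenTree.Node 7 [::]
  | TApp _ _ u v => GenTree.Node 8 [:: term_tree _ u; term_tree _ v]
  end.

Definition sigma_app (a b : {s : ty & term s}) : option {s : ty & term s} :=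
  match a with
  | existT (Arr s t) u => fun b =>
      let: existT s' v := b in
      if ty_eq_dec s' s is left e
      then Some (existT _ t (TApp u (eq_rect s' term v s e))) else None
  | _ => fun=> None
  end b.

Fixpoint tree_term (t : tree) : option {s : ty & term s} :=
  match t with
  | GenTree.Node 0 [:: GenTree.Leaf n] => Some (existT _ _ (TNum n))
  | GenTree.Node 1 [:: a; b] => Some (existT _ _ (TK (tree_ty a) (tree_ty b)))
  | GenTree.Node 2 [:: a; b; c] =>
      Some (existT _ _ (TS (tree_ty a) (tree_ty b) (tree_ty c)))
  | GenTree.Node 3 [:: a] => Some (existT _ _ (TR (tree_ty a)))
  | GenTree.Node 4 [:: GenTree.Leaf k] => Some (existT _ _ (TPhi k))
  | GenTree.Node 5 [:: GenTree.Leaf i] => Some (existT _ _ (TX i))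
  | GenTree.Node 6 _ => Some (existT _ _ TF)
  | GenTree.Node 7 _ => Some (existT _ _ TG)
  | GenTree.Node 8 [:: a; b] =>
      if (tree_term a, tree_term b) is (Some u, Some v) then sigma_app u v
      else None
  | _ => None
  end.

Lemma term_treeK (s : ty) (u : term s) :
  tree_term (term_tree s u) = Some (existT _ s u).
Proof.
elim: u => //= [r s'|d r t|r|s' t u -> v ->]; rewrite ?ty_treeK //=.
by case: ty_eq_dec => // e; rewrite (Prop_irrelevance e erefl).
Qed.

(** Lets the type-one terms be treated one per step of a countable fusion; [u0] fills the codes that
    name no term of type [s]. *)
Lemma term_enum (s : ty) (u0 : term s) :
  exists e : nat -> term s, forall u, exists n, e n = u.
Proof.
pose e n := if obind tree_term (unpickle n) is Some (existT s' v)
  then if ty_eq_dec s' s is left E then eq_rect s' term v s E else u0 else u0.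
exists e => u; exists (pickle (term_tree s u)).
rewrite /e pickleK /= term_treeK; case: ty_eq_dec => // E.
by rewrite (Prop_irrelevance E erefl).
Qed.

(** * Forcing conditions and good names *)

(** Pairing into the positive numbers: the columns [pr n] are infinite and pairwise disjoint, and
    column [n] lies above [n]. *)
Definition pr (n j : nat) : nat := 2 ^ n * j.*2.+1.

Lemma pr_inj n j n' j' : pr n j = pr n' j' -> n = n' /\ j = j'.
Proof.
have lpr a b : logn 2 (pr a b) = a.
  rewrite /pr lognM ?expn_gt0 // pfactorK // lognE dvdn2 /= odd_double /=.
  by rewrite addn0.
move=> E; have En : n = n' by rewrite -(lpr n j) E lpr.
split=> //; move: E; rewrite /pr En => /eqP; rewrite eqn_pmul2l ?expn_gt0 //.
by rewrite eqSS => /eqP /double_inj.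
Qed.

Lemma pr_gt n j : n < pr n j.
Proof. by apply: leq_trans (ltn_expl n (ltnSn 1)) _; rewrite leq_pmulr. Qed.

Definition cond := fn -> option (nat * nat).

Definition le (p q : cond) := forall f v, p f = Some v -> q f = Some v.
Definition compat (p : cond) (H : oracle) := forall f v, p f = Some v -> H f = v.

Lemma le_trans q p r : le p q -> le q r -> le p r.
Proof. by move=> pq qr f v /pq /qr. Qed.

Lemma compat_le {p q H} : le p q -> compat q H -> compat p H.
Proof. by move=> pq qH f v /pq /qH. Qed.

Lemma chain_le (c : nat -> cond) : (forall i, le (c i) (c i.+1)) ->
  forall i j, i <= j -> le (c i) (c j).
Proof.
move=> cS i j /subnK <-; elim: (j - i) => [|k IH] //.
exact: le_trans IH (cS _).
Qed.

Definition lim (c : nat -> cond) : cond := fun f =>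
  if pselect (exists v, exists i, c i f = Some v) is left e
  then Some (projT1 (cid e)) else None.

Lemma limP c : (forall i, le (c i) (c i.+1)) ->
  forall f v, lim c f = Some v <-> exists i, c i f = Some v.
Proof.
move=> cS f v; rewrite /lim; case: pselect => [e|ne]; last first.
  by split=> // h; case: ne; exists v.
case: cid => u [i ci] /=; split=> [[<-]|[j cj]]; first by exists i.
congr Some; apply: Some_inj.
by rewrite -(chain_le c cS _ _ (leq_maxl i j) _ _ ci)
           -(chain_le c cS _ _ (leq_maxr i j) _ _ cj).
Qed.

Lemma chain_entry (c : nat -> cond) f v i :
  c 0 f = None -> c i f = Some v -> (forall i, le (c i) (c i.+1)) ->
  exists2 k, c k f = None & c k.+1 f = Some v.
Proof.
move=> c0 ci cS; elim: i ci => [|i IH] ci; first by rewrite c0 in ci.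
case E: (c i f) => [u|]; last by exists i.
by apply: IH; rewrite E; move/cS: E; rewrite ci => -[->].
Qed.

(* New oracle values come from the budget [w], which can be split into
   countably many disjoint budgets [w \o pr i]; keeping [w] injective makes
   the second oracle injective on what has been queried so far. *)
Definition ext (w : fn) (p q : cond) :=
  [/\ le p q,
      forall f v, p f = None -> q f = Some v -> v.1 = 0 /\ exists j, v.2 = w j
    & forall f g v v', p f = None -> p g = None -> q f = Some v ->
        q g = Some v' -> v.2 = v'.2 -> f = g].

Definition dense (D : cond -> Prop) :=
  forall p w, injective w -> exists2 q, ext w p q & D q.

Lemma ext_refl w p : ext w p p.
Proof. by split=> // [f v ->|f g v v' ->]. Qed.

(** Stage [i] draws only on column [i] of the budget, so equal new second components entered at the
    same stage, where injectivity is given. *)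
Lemma ext_chain w (c : nat -> cond) : injective w ->
  (forall i, ext (w \o pr i) (c i) (c i.+1)) -> ext w (c 0) (lim c).
Proof.
move=> winj cS; have cle i : le (c i) (c i.+1) by case: (cS i).
split=> [f v c0|f v c0 /(limP c cle)[i ci]|f g v v' f0 g0].
- by apply/(limP c cle); exists 0.
- have [k ck ck1] := chain_entry _ _ _ _ c0 ci cle.
  case: (cS k) => _ /(_ _ _ ck ck1)[v1 [j v2]] _.
  by split=> //; exists (pr k j).
- move=> /(limP c cle)[i ci] /(limP c cle)[i' ci'] E.
  have [k ck ck1] := chain_entry _ _ _ _ f0 ci cle.
  have [l cl cl1] := chain_entry _ _ _ _ g0 ci' cle.
  case: (cS k) => _ /(_ _ _ ck ck1)[_ [j v2]] I.
  case: (cS l) => _ /(_ _ _ cl cl1)[_ [j' v2']] _.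
  move: (E); rewrite v2 v2' /= => /winj /pr_inj [kl _].
  by rewrite -kl in cl cl1; apply: (I _ _ _ _ ck cl ck1 cl1).
Qed.

Definition upward (D : cond -> Prop) := forall p q, le p q -> D p -> D q.

(** Fusion: step [i] meets [D i] within budget [w \o pr i], and upward closure carries [D i] to the
    limit. *)
Lemma dense_all (D : nat -> cond -> Prop) :
  (forall i, upward (D i)) -> (forall i, dense (D i)) ->
  dense (fun q => forall i, D i q).
Proof.
move=> up dn p w winj.
have wi i : injective (w \o pr i) by move=> a b /= /winj /pr_inj [].
have [nx nxP] : {nx : nat * cond -> cond & forall ip,
    ext (w \o pr ip.1) ip.2 (nx ip) /\ D ip.1 (nx ip)}.
  apply: (@choice _ _ (fun ip q => ext (w \o pr ip.1) ip.2 q /\ D ip.1 q)).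
  by move=> [i r] /=; have [q] := dn i r _ (wi i); exists q.
pose c := fix c i := if i is j.+1 then nx (j, c j) else p.
have cS i : ext (w \o pr i) (c i) (c i.+1) by case: (nxP (i, c i)).
exists (lim c); first exact: (ext_chain _ c).
move=> i; have [_ Di] := nxP (i, c i); apply: up Di => f v ci.
by apply/limP; [move=> k; case: (cS k) | exists i.+1].
Qed.

Lemma dense_bind (D E : cond -> Prop) :
  dense D -> (forall p w, injective w -> D p -> exists2 q, ext w p q & E q) ->
  dense E.
Proof.
move=> dD DE p w winj.
have wi i : injective (w \o pr i) by move=> a b /= /winj /pr_inj [].
have [q pq Dq] := dD p _ (wi 0); have [r qr Er] := DE _ _ (wi 1) Dq.
(* Two successive extensions form an eventually constant chain, so [ext_chain] combines their
   budgets. *)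
pose c i := match i with 0 => p | 1 => q | _ => r end.
have cS i : ext (w \o pr i) (c i) (c i.+1).
  by case: i => [|[|i]] //=; apply: ext_refl.
exists r => //.
suff -> : r = lim c by apply: (ext_chain _ c).
have cle i : le (c i) (c i.+1) by case: (cS i).
apply: funext => f; case E1: (r f) => [v|].
  by apply/esym/(limP c cle); exists 2.
case E2: (lim c f) => [v|] //; move/(limP c cle): E2 => [i ci].
have := chain_le c cle i (i + 2) (leq_addr _ _) _ _ ci.
by rewrite addnC /= E1.
Qed.

Lemma dense_sub (D E : cond -> Prop) :
  (forall q, D q -> E q) -> dense D -> dense E.
Proof. by move=> DE dD p w /(dD p)[q pq /DE]; exists q. Qed.

(** * Deciding the values of names *)

Definition decides {T : Type} (X : oracle -> T) (q : cond) :=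
  exists a, forall H, compat q H -> X H = a.

Lemma decides_up {T : Type} (X : oracle -> T) : upward (decides X).
Proof. by move=> p q pq [a Xa]; exists a => H /(compat_le pq) /Xa. Qed.

Lemma dense_decides_fun {T : Type} (X : oracle -> nat -> T) :
  (forall n, dense (decides (X^~ n))) -> dense (decides X).
Proof.
move=> dX; apply: dense_sub (dense_all _ (fun n => decides_up (X^~ n)) dX).
move=> q /choice[a Xa]; exists a => H qH.
by apply: funext => n; apply: Xa.
Qed.

(* A name is good when every condition has extensions, within any budget,
   that decide it; hereditarily so at higher types. *)
Fixpoint good (s : ty) : (oracle -> full s) -> Prop :=
  match s return (oracle -> full s) -> Prop with
  | Zero => fun X => dense (decides X)
  | Arr s t => fun X => forall a, good s a -> good t (fun H => X H (a H))
  end.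

Lemma good_cst n : good Zero (fun=> n).
Proof. by move=> p w _; exists p; [apply: ext_refl | exists n]. Qed.

(** A numerical name can be decided first and then replaced by its value; higher types reduce to
    this pointwise. *)
Lemma good_glue t (n : oracle -> nat) (X : nat -> oracle -> full t) :
  good Zero n -> (forall m, good t (X m)) -> good t (fun H => X (n H) H).
Proof.
elim: t X => [|s _ t IH] X gn gX /=; last first.
  by move=> a ga; apply: (IH (fun m H => X m H (a H))) => // m; apply: gX.
apply: dense_bind gn _ => p w winj [m nm].
have [q pq [a Xa]] := gX m p w winj; exists q => //; exists a => H qH.
by case: pq => pq _ _; rewrite (nm _ (compat_le pq qH)) Xa.
Qed.

Lemma good_fun1 (X : oracle -> fn) : good One X -> dense (decides X).
Proof. by move=> gX; apply: dense_decides_fun => n; apply: gX (good_cst n). Qed.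

Lemma good_fun2 (X : oracle -> nat -> fn) :
  good (Arr Zero One) X -> dense (decides X).
Proof.
move=> gX; apply: dense_decides_fun => n.
by apply: good_fun1; apply: gX (good_cst n).
Qed.

Definition upd {T : Type} (q : fn -> T) (y : fn) (v : T) : fn -> T :=
  fun g => if `[< g = y >] then v else q g.

Lemma dense_query (X : oracle -> fn) : dense (decides X) ->
  dense (fun q => exists f v, (forall H, compat q H -> X H = f) /\ q f = Some v).
Proof.
move=> dX; apply: dense_bind dX _ => p w winj [f Xf].
case E: (p f) => [v|]; first by exists p; [apply: ext_refl | exists f, v].
(* A function not yet queried gets the value 0 for [F] and a number from the budget for [G]. *)
pose q := upd p f (Some (0, w 0)).
have pq : le p q.
  by move=> g v; rewrite /q /upd; case: asboolP => // -> ; rewrite E.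
exists q; last first.
  exists f, (0, w 0); split; last by rewrite /q /upd; case: asboolP.
  by move=> H /(compat_le pq) /Xf.
split=> // [g v|g g' v v']; rewrite /q /upd.
  by case: asboolP => [_ _ [<-]|_ ->] //; split=> //; exists 0.
by case: asboolP => [->|_ ->] //; case: asboolP => [->|_ _ ->].
Qed.

Lemma good_oracle (X : oracle -> fn) (b : nat * nat -> nat) : good One X ->
  good Zero (fun H => b (H (X H))).
Proof.
move=> /good_fun1 /dense_query; apply: dense_sub => q [f [v [Xf qf]]].
by exists (b v) => H qH; rewrite (Xf _ qH) (qH _ _ qf).
Qed.

(** Fundamental lemma of the logical relation [good]. An argument of [Phi k] consists of countably
    many numbers, so one condition decides it outright, and with it the value of [Phi k]. *)
Lemma good_eval Phi x (s : ty) (u : term s) : good s (fun H => eval Phi x H u).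
Proof.
elim: u => {s} //=.
- exact: good_cst.
- move=> d r t a ga b gb c gc; apply: ga => //; exact: gb.
- move=> r n gn y gy z gz.
  apply: (good_glue r n (fun m H => recf r m (y H) (z H))) => //.
  elim=> [|m IH]; first exact: gy.
  exact: (gz _ IH _ (good_cst m)).
- move=> k X gX n gn.
  apply: (good_glue Zero n (fun m H => Phi k (X H) m)) => // m.
  apply: dense_sub (good_fun2 X gX) => q [a Xa].
  by exists (Phi k a m) => H /Xa ->.
- move=> i n gn; apply: (good_glue Zero n (fun m _ => x i m)) => // m.
  exact: good_cst.
- by move=> X gX; apply: (good_oracle X fst).
- by move=> X gX; apply: (good_oracle X snd).
- by move=> s t u gu v gv; apply: gu.
Qed.

Lemma dense_eval Phi x : dense (fun q => forall u : term One,
  exists f v, (forall H, compat q H -> eval Phi x H u = f) /\ q f = Some v).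
Proof.
have [e eP] := term_enum One (TX 0).
pose D i q := exists f v,
  (forall H, compat q H -> eval Phi x H (e i) = f) /\ q f = Some v.
apply: (dense_sub (fun q => forall i, D i q)) => [q Dq u|].
  by have [i <-] := eP u; apply: Dq.
apply: dense_all => i.
  move=> p q pq [f [v [ef pf]]]; exists f, v; split; last exact: pq.
  by move=> H /(compat_le pq) /ef.
by apply/dense_query/good_fun1/(good_eval Phi x _ (e i)).
Qed.

(** * The generic oracle *)

Fixpoint bound (s : ty) (u : term s) : nat :=
  match u with
  | TX i => i.+1
  | TApp _ _ u v => maxn (bound _ u) (bound _ v)
  | _ => 0
  end.

Lemma eval_bound Phi x x' H (s : ty) (u : term s) :
  (forall i, i < bound s u -> x i = x' i) -> eval Phi x H u = eval Phi x' H u.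
Proof.
elim: u => //= [i -> //|s' t u IHu v IHv E].
by rewrite IHu ?IHv // => i iu; apply: E; rewrite leq_max iu ?orbT.
Qed.

(** When second components are injective, at most one [f] has [G f = m + 1], so the value at [m] is
    free to differ from [f m]. *)
Definition diag (q : cond) : fn := fun m =>
  if pselect (exists f v, q f = Some v /\ v.2 = m.+1) is left e
  then (projT1 (cid e) m == 0 : nat) else 0.

Definition inj2 (q : cond) := forall f g v v',
  q f = Some v -> q g = Some v' -> v.2 = v'.2 -> f = g.

Lemma diag_le1 q m : diag q m <= 1.
Proof. by rewrite /diag; case: pselect => // e; case: eqP. Qed.

Lemma diagP q f v m : inj2 q -> q f = Some v -> v.2 = m.+1 -> diag q m <> f m.
Proof.
move=> iq qf vm; rewrite /diag; case: pselect => [e|[]]; last by exists f, v.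
case: cid => g [v' [qg v'm]] /=; rewrite (iq g f v' v) ?v'm //.
by case: (f m).
Qed.

(** Column [n.*2] supplies the queries of stage [n]; column [n.*2.+1] is kept for the value of [G]
    at [x n]. *)
Definition step_ok Phi (n : nat) (x : nat -> fn) (p q : cond) :=
  ext (pr n.*2) p q /\ forall u : term One,
    exists f v, (forall H, compat q H -> eval Phi x H u = f) /\ q f = Some v.

Lemma generic_sequence Phi : exists (x : nat -> fn) (p q : nat -> cond),
  [/\ p 0 = (fun=> None),
      forall n, p n.+1 = upd (q n) (x n) (Some (n, pr n.*2.+1 0)),
      forall n, x n = diag (q n) &
      forall n, step_ok Phi n (fun i => if i < n then x i else id) (p n) (q n)].
Proof.
have [qs qsP] : {qs : nat * (nat -> fn) * cond -> cond &
    forall a, step_ok Phi a.1.1 a.1.2 a.2 (qs a)}.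
  apply: (@choice _ _ (fun a q => step_ok Phi a.1.1 a.1.2 a.2 q)).
  move=> [[n x] p]; have [|q] := dense_eval Phi x p (pr n.*2); last by exists q.
  by move=> i j /pr_inj [].
(* The state holds the [x i] chosen so far, with [id] as placeholder for the others, and the current
   condition. *)
pose st := fix st n : (nat -> fn) * cond := if n is m.+1 then
    let q := qs (m, (st m).1, (st m).2) in
    (fun i => if i == m then diag q else (st m).1 i,
     upd q (diag q) (Some (m, pr m.*2.+1 0)))
  else (fun=> id, fun=> None).
pose q n := qs (n, (st n).1, (st n).2).
exists (fun n => diag (q n)), (fun n => (st n).2), q; split=> // n.
have -> : (fun i => if i < n then diag (q i) else id) = (st n).1.
  apply: funext; elim: n => [|n IH] i //=; rewrite ltnS -IH.
  by case: ltngtP => // ->.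
exact: (qsP (n, (st n).1, (st n).2)).
Qed.

Definition ranged (n : nat) (p : cond) :=
  forall f v, p f = Some v -> exists a j, v.2 = pr a j /\ a < n.

(** Old second components lie in columns below [n] and new ones in column [n], so they never
    coincide. *)
Lemma ext_ranged n p q : ext (pr n) p q -> inj2 p -> ranged n p ->
  inj2 q /\ ranged n.+1 q.
Proof.
move=> [pq new newinj] pinj prg; split; last first.
  move=> f v qf; case E: (p f) => [u|].
    move: (pq _ _ E); rewrite qf => -[->]; have [a [j [-> an]]] := prg _ _ E.
    by exists a, j; split=> //; apply: ltnW.
  by have [_ [j ->]] := new _ _ E qf; exists n, j.
have old_new f g v v' u : p f = Some u -> p g = None -> q f = Some v ->
    q g = Some v' -> v.2 <> v'.2.
  move=> pf pg qf qg; have [_ [j ->]] := new _ _ pg qg.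
  move: (pq _ _ pf); rewrite qf => -[->]; have [a [j' [-> an]]] := prg _ _ pf.
  by move=> /pr_inj [an' _]; rewrite an' ltnn in an.
move=> f g v v' qf qg E; case Ef: (p f) => [u|]; case Eg: (p g) => [u'|].
- apply: (pinj _ _ _ _ Ef Eg).
  by move: (pq _ _ Ef) (pq _ _ Eg); rewrite qf qg => -[<-] [<-].
- by case: (old_new _ _ _ _ _ Ef Eg qf qg).
- by case: (old_new _ _ _ _ _ Eg Ef qg qf).
- exact: newinj Ef Eg qf qg E.
Qed.

Lemma upd_ranged n m q y : inj2 q -> ranged n q ->
  inj2 (upd q y (Some (m, pr n 0))) /\ ranged n.+1 (upd q y (Some (m, pr n 0))).
Proof.
move=> qinj qrg.
have old_new f v : q f = Some v -> v.2 <> pr n 0.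
  move=> /qrg[a [j [-> an]]] /pr_inj[an' _].
  by rewrite an' ltnn in an.
split=> [f g v v'|f v]; rewrite /upd.
  case: asboolP => [->|_]; case: asboolP => [->|_] //.
  - by move=> [<-] /old_new v'n /= E; case: v'n.
  - by move=> /old_new vn [<-] /= E; case: vn.
  - exact: qinj.
case: asboolP => [_ [<-]|_ /qrg[a [j [-> an]]]]; first by exists n, 0.
by exists a, j; split=> //; apply: ltnW.
Qed.

Lemma generic_oracle Phi : exists (x : nat -> fn) (H : oracle),
  [/\ forall n m, x n m <= 1,
      forall n, (H (x n)).1 = n &
      forall u v : term One, let f := eval Phi x H u in let g := eval Phi x H v in
        (forall i, i < (H f).2 -> g i = f i) -> (H g).1 <= (H f).2].
Proof.
have [x [p [q [p0 pS xE stepP]]]] := generic_sequence Phi.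
have pq n : ext (pr n.*2) (p n) (q n) by case: (stepP n).
have p_ranged n : inj2 (p n) /\ ranged n.*2 (p n).
  elim: n => [|n [pinj prg]]; first by rewrite p0; split.
  have [qinj qrg] := ext_ranged _ _ _ (pq n) pinj prg.
  by rewrite pS; apply: upd_ranged.
have q_ranged n : inj2 (q n) /\ ranged n.*2.+1 (q n).
  by have [pinj prg] := p_ranged n; apply: ext_ranged (pq n) pinj prg.
(* The disagreement sits at [v.2 - 1], just inside the neighbourhood; [v.2] is positive because all
   values of [pr] are. *)
have q_avoid n f v : q n f = Some v ->
    exists2 l, l < v.2 & x n l <> f l.
  have [qinj qrg] := q_ranged n => qf.
  have v0 : 0 < v.2.
    by have [a [j [-> _]]] := qrg _ _ qf; apply: leq_trans (pr_gt a j).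
  exists v.2.-1; rewrite ?prednK // xE.
  by apply: diagP qf _ => //; rewrite prednK.
have qx n : q n (x n) = None.
  by case E: (q n (x n)) => [v|] //; have [l] := q_avoid _ _ _ E.
have pqle n : le (p n) (q n) by case: (pq n).
have qple n : le (q n) (p n.+1).
  move=> f v qf; rewrite pS /upd; case: asboolP => // fx.
  by rewrite fx qx in qf.
have pple n : le (p n) (p n.+1) by apply: le_trans (pqle n) (qple n).
(* By [dom] below, the default is never met at a function denoted by a term. *)
pose H f := odflt (0, 0) (lim p f).
have Hp n : compat (p n) H.
  move=> f v pf; rewrite /H.
  suff -> : lim p f = Some v by [].
  by apply/(limP p pple); exists n.
have Hq n : compat (q n) H by apply: compat_le (Hp n.+1).
have px n : p n.+1 (x n) = Some (n, pr n.*2.+1 0).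
  by rewrite pS /upd; case: asboolP.
exists x, H; split.
- by move=> n m; rewrite xE diag_le1.
- by move=> n; rewrite (Hp _ _ _ (px n)).
(* The sequence used at stage [b] agrees with [x] on all constants of [u], so [q b] is already
   defined at the value of [u]. *)
have dom (u : term One) : exists k v, p k (eval Phi x H u) = Some v.
  pose b := bound One u; have [_ /(_ u)[f [v [ef qf]]]] := stepP b.
  exists b.+1, v; apply: qple; rewrite -qf; congr (q b _).
  rewrite -(ef _ (Hq b)); apply: (eval_bound Phi x _ H One u) => i.
  by rewrite -/b => ->.
have entry k f v : p k f = Some v -> exists n,
    (p n f = None /\ q n f = Some v) \/ (f = x n /\ v = (n, pr n.*2.+1 0)).
  move=> pk; have p0f : p 0 f = None by rewrite p0.
  have [n pn pn1] := chain_entry p f v k p0f pk pple.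
  exists n; move: pn1; rewrite pS /upd.
  by case: asboolP => [-> [<-]|_ ->]; [right | left].
move=> u v f g gf; have [kf [vf pf]] := dom u; have [kg [vg pg]] := dom v.
rewrite -/f in pf; rewrite -/g in pg.
have Hf := Hp _ _ _ pf; have Hg := Hp _ _ _ pg; rewrite Hf in gf *; rewrite Hg.
(* Either [g] was added by a query, and [F g = 0], or [g = x m] and [F g = m]. *)
have [m [[pm qm]|[gx ->]]] := entry _ _ _ pg.
  by have [_ new _] := pq m; have [-> _] := new _ _ pm qm.
(* If [f] is already in [q m], then [x m] avoids its neighbourhood, contradicting [gf]. *)
case Eq: (q m f) => [v'|].
  move: (Hq _ _ _ Eq); rewrite Hf => E; rewrite -{v'}E in Eq.
  by have [l lv] := q_avoid _ _ _ Eq; case; rewrite -gx gf.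
(* Otherwise [f] enters at a stage [n >= m], and both columns [n.*2] and [n.*2.+1] lie above [n]. *)
have late n : p n.+1 f = Some vf -> m <= n.
  by move=> pn; case: leqP => // /chain_le -/(_ p pple) /(_ f vf pn) /pqle; rewrite Eq.
have [n [[pn qn]|[fx vE]]] := entry _ _ _ pf.
  have [_ new _] := pq n; have [_ [j ->]] := new _ _ pn qn.
  apply: leq_trans (late _ (qple _ _ _ qn)) _.
  by apply: ltnW; apply: leq_ltn_trans (pr_gt _ j); rewrite -addnn leq_addr.
rewrite vE; apply: (@leq_trans n).
  by apply: late; rewrite fx px vE.
apply: ltnW; apply: leq_ltn_trans (pr_gt _ 0).
by rewrite -addnn -addSn leq_addl.
Qed.

(** * The term model *)

Fixpoint full_nf (f : fn) (k : nat) (ex : bool) (gs : seq fn) : Prop :=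
  match k with
  | 0 =>
      let P := fun n : nat =>
        f (code (flatten [seq [seq g i | i <- iota 0 n] | g <- gs])) = 0 in
      if ex then exists n, P n else forall n, P n
  | k'.+1 =>
      if ex then exists g, full_nf f k' (~~ ex) (rcons gs g)
      else forall g, full_nf f k' (~~ ex) (rcons gs g)
  end.

Definition pick_fn (P : fn -> Prop) : fn :=
  if pselect (exists g, P g) is left e then projT1 (cid e) else id.

Lemma pick_fnP (P : fn -> Prop) g : P g -> P (pick_fn P).
Proof.
move=> Pg; rewrite /pick_fn; case: pselect => [e|[]]; first by case: cid.
by exists g.
Qed.

(** Verifies an existential quantifier if [b] holds, and refutes a universal one otherwise. *)
Definition witness (f : fn) (gs : seq fn) (k : nat) (b : bool) (g : fn) : Prop :=
  if b then full_nf f k false (rcons gs g) else ~ full_nf f k true (rcons gs g).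

(* With [0] read as "true", [inl 1] decides equality and [inl 2] is nand;
   [inl 3] finds a zero, [inl k.+4] is [S_k] and [inr] are Skolem functions.
   The argument [s] lists type-one parameters. *)
Definition phi (c : nat + nat * nat * bool) (s : nat -> fn) : fn :=
  match c with
  | inl 0 => succn
  | inl 1 => fun n => s 0 0 != n
  | inl 2 => fun n => (s 0 0 == 0) && (n == 0)
  | inl 3 => fun=> if pselect (exists n, s 0 n = 0) is left e
                   then projT1 (cid e) else 0
  | inl k.+4 => fun=> ~~ `[< full_nf (s 0) k true [::] >]
  | inr (k, m, b) => pick_fn (witness (s 0) [seq s i.+1 | i <- iota 0 m] k b)
  end.

Definition Phi (k : nat) : (nat -> fn) -> fn :=
  if unpickle k is Some c then phi c else fun=> id.

Definition TPhi_of (c : nat + nat * nat * bool) : term (Arr (Arr Zero One) One) :=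
  TPhi (pickle c).

Lemma PhiE c : Phi (pickle c) = phi c.
Proof. by rewrite /Phi pickleK. Qed.

(** * Programming with combinators *)

Definition tcomp {r s t} (u : term (Arr s t)) (v : term (Arr r s)) :
  term (Arr r t) := TApp (TApp (TS r s t) (TApp (TK (Arr s t) r) u)) v.

Definition tcst {r s} (u : term s) : term (Arr r s) := TApp (TK s r) u.

Definition tat0 (u : term (Arr One One)) : term Two :=
  TApp (TApp (TS One Zero Zero) u) (tcst (TNum 0)).

(** The recursor as case distinction: index 0 gives [u] and index [n + 1] gives [v n], the previous
    value being discarded. *)
Definition tcons (u : term One) (v : term (Arr Zero One)) : term (Arr Zero One) :=
  TApp (TApp (TS Zero _ _) (TApp (TApp (TS Zero _ _) (TR One)) (tcst u)))
       (tcst (tcst v)).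

(** Application under two abstractions, over [f] and [n]. *)
Definition tap2 {s t} (u : term (Arr One (Arr Zero (Arr s t))))
    (v : term (Arr One (Arr Zero s))) : term (Arr One (Arr Zero t)) :=
  TApp (TApp (TS One (Arr Zero s) (Arr Zero t)) (tcomp (TS Zero s t) u)) v.

(** A number [a] is passed to [Phi] as the constant sequence of constant functions, so that [s 0 0]
    in [phi] is [a]. *)
Definition tbin (k : nat) (u v : term (Arr One One)) : term (Arr One One) :=
  let op := tcomp (TPhi_of (inl k)) (tcomp (TK One Zero) (TK Zero Zero)) in
  tap2 (tap2 (tcst (tcst op)) u) v.

Section TermModel.
Variables (x : nat -> fn) (H : oracle).

Notation ev0 u := (eval Phi x H u).

Definition denoted (s : ty) (a : full s) : Prop := exists u : term s, ev0 u = a.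

Definition car (s t : ty) : Type := {a : full (Arr s t) | denoted (Arr s t) a}.

Definition val (s : ty) : el_of car s -> full s :=
  match s with Zero => fun n => n | Arr _ _ => fun a => proj1_sig a end.
Arguments val {s}.

Definition mk (s : ty) : forall a : full s, denoted s a -> el_of car s :=
  match s with Zero => fun a _ => a | Arr _ _ => fun a d => exist _ a d end.

Lemma val_mk s a (d : denoted s a) : val (mk s a d) = a.
Proof. by case: s a d. Qed.

Lemma val_denoted (s : ty) (a : el_of car s) : denoted s (val a).
Proof. by case: s a => [n|s t [a d]] //; exists (TNum n). Qed.

Lemma denoted_ap s t (a : full (Arr s t)) b :
  denoted (Arr s t) a -> denoted s b -> denoted t (a b).
Proof. by move=> [u <-] [v <-]; exists (TApp u v). Qed.

Lemma denoted_car_ap s t (a : car s t) (b : el_of car s) :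
  denoted t (proj1_sig a (val b)).
Proof.
by case: a => a da; apply: denoted_ap da (val_denoted s b).
Qed.

Definition model : tstruct :=
  TStruct car (fun s t a b => mk t _ (denoted_car_ap s t a b)).

Lemma val_ap s t (a : el model (Arr s t)) (b : el model s) :
  @val t (ap a b) = @val (Arr s t) a (@val s b).
Proof. by case: t a. Qed.

Definition of_term {s} (u : term s) : el model s :=
  mk s (ev0 u) (ex_intro _ u erefl).

Lemma val_of_term s (u : term s) : @val s (of_term u) = ev0 u.
Proof. exact: val_mk. Qed.

(** Denoted functionals live on the full structure and may differ outside the denoted arguments.
    This logical relation over denoted arguments turns out to be equality in the model. *)
Fixpoint sim (s : ty) : full s -> full s -> Prop :=
  match s return full s -> full s -> Prop with
  | Zero => fun a b => a = b
  | Arr s t => fun a b => forall c d, denoted s c -> denoted s d ->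
      sim s c d -> sim t (a c) (b d)
  end.

Lemma sim_fn (f g : fn) : sim One f g -> f = g.
Proof. by move=> E; apply: funext => n; apply: E => //; exists (TNum n). Qed.

Lemma denoted_num n : denoted Zero n.
Proof. by exists (TNum n). Qed.

(** Induction on terms. [Phi k] and the oracles respect the relation because it is true equality at
    type one, every number being denoted. *)
Lemma sim_refl s a : denoted s a -> sim s a a.
Proof.
move=> [u <-]; elim: u {a} => {s} //=.
- move=> d r t a a' _ _ E b b' db db' F c c' dc dc' G.
  exact: (E c c' dc dc' G _ _ (denoted_ap _ _ _ _ db dc)
           (denoted_ap _ _ _ _ db' dc') (F _ _ dc dc' G)).
- move=> r n n' _ _ <- y y' dy dy' E z z' dz dz' F.
  have drec m b c : denoted r b -> denoted (Arr r (Arr Zero r)) c ->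
      denoted r (recf r m b c).
    by move=> [u <-] [v <-]; exists (TApp (TApp (TApp (TR r) (TNum m)) u) v).
  elim: n => [|m IH] //=.
  by apply: (F _ _ _ _ IH m m (denoted_num m) (denoted_num m)) => //; apply: drec.
- move=> k s s' _ _ E n n' _ _ <-; suff -> : s = s' by [].
  apply: funext => m; apply: sim_fn; exact: (E _ _ (denoted_num m) (denoted_num m)).
- by move=> i n n' _ _ ->.
- by move=> f g _ _ /sim_fn ->.
- by move=> f g _ _ /sim_fn ->.
- by move=> s t u IHu v IHv; apply: IHu => //; exists v.
Qed.

Lemma sim_trans s b a c : denoted s b ->
  sim s a b -> sim s b c -> sim s a c.
Proof.
elim: s b a c => [|s _ t IH] b a c db; first by move=> /= -> ->.
move=> ab bc d e dd de E; apply: (IH (b e)); first exact: denoted_ap.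
  exact: ab.
by apply: bc => //; apply: sim_refl.
Qed.

Lemma eqT_sim s (a b : el model s) :
  eqT model s a b <-> sim s (@val s a) (@val s b).
Proof.
elim: s a b => [|s IHs t IHt] a b //; split=> [E c d dc dd F|E c].
  (* The argument is changed first, by [sim_refl] for [a], and the function afterwards. *)
  apply: (sim_trans _ (@val (Arr s t) a d)).
  - by apply: denoted_ap dd; apply: val_denoted.
  - by apply: (sim_refl (Arr s t)) => //; apply: val_denoted.
  - by rewrite -(val_mk s d dd) -!val_ap; apply/IHt/E.
apply/IHt; rewrite !val_ap; apply: E; try exact: val_denoted.
by apply: sim_refl; apply: val_denoted.
Qed.

Lemma eqT_val s (a b : el model s) : @val s a = @val s b -> eqT model s a b.
Proof. by move=> E; apply/eqT_sim; rewrite E; apply/sim_refl/val_denoted. Qed.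

Lemma model_ext : ext_ax model.
Proof.
move=> s t F a b /eqT_sim E; apply/eqT_sim; rewrite !val_ap.
apply: (sim_refl (Arr s t)) => //; exact: val_denoted.
Qed.

(** * The axioms of the base theory in the model *)

Lemma model_succ : has_succ model.
Proof.
exists (@of_term One (TApp (TPhi_of (inl 0)) (TK Zero Zero))) => n.
by rewrite /= PhiE.
Qed.

Lemma model_Pi : has_Pi model.
Proof.
move=> r s; exists (of_term (TK r s)) => a b.
by apply: eqT_val; rewrite !val_ap.
Qed.

Lemma model_Sigma : has_Sigma model.
Proof.
move=> d r t; exists (of_term (TS d r t)) => a b c.
by apply: eqT_val; rewrite !val_ap.
Qed.

Lemma model_Rec : has_Rec model.
Proof.
move=> r; exists (of_term (TR r)) => y z; split=> [|n];
  by apply: eqT_val; rewrite !val_ap.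
Qed.

(** Bracket abstraction of both free variables; parameters are denoted and so become closed
    subterms. *)
Lemma tm_term s (u : tm model s) :
  exists t : term (Arr One (Arr Zero s)), forall (f : el model One) n,
    ev0 t (@val One f) n = @val s (ev model s u f n).
Proof.
elim: u => {s} [s a|||s t u [u' Eu] v [v' Ev]].
- by have [w Ew] := val_denoted s a; exists (tcst (tcst w)).
- by exists (TK One Zero).
- by exists (tcst (TApp (TApp (TS Zero One Zero) (TK Zero One)) (TK Zero Zero))).
- by exists (tap2 u' v') => f n; rewrite /= val_ap -Eu -Ev.
Qed.

(** Truth is coded by 0, and negation and the binary connectives reduce classically to nand. *)
Lemma qf_term (A : qf model) :
  exists t : term (Arr One One), forall (f : el model One) n,
    qsat model A f n <-> ev0 t (@val One f) n = 0.
Proof.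
have nandP (u v : term (Arr One One)) f n :
    ev0 (tbin 2 u v) f n = 0 <-> ~ (ev0 u f n = 0 /\ ev0 v f n = 0).
  by rewrite /= PhiE /=; case: eqP => ?; case: eqP => ?; split=> //=; tauto.
elim: A => /= [u v||B [b Eb]|B [b Eb] C [c Ec]|B [b Eb] C [c Ec]|B [b Eb] C [c Ec]].
- have [u' Eu] := tm_term _ u; have [v' Ev] := tm_term _ v.
  exists (tbin 1 u' v') => f n; rewrite /= PhiE /= Eu Ev /=.
  by case: eqP.
- by exists (tcst (tcst (TNum 1))).
- by exists (tbin 2 b b) => f n; rewrite nandP Eb; tauto.
- exists (tbin 2 (tbin 2 b c) (tbin 2 b c)) => f n; rewrite !nandP Eb Ec.
  by split=> [|h]; [tauto | apply: contrapT; tauto].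
- exists (tbin 2 (tbin 2 b b) (tbin 2 c c)) => f n; rewrite !nandP Eb Ec.
  by split=> [|h]; [tauto | apply: contrapT; tauto].
- exists (tbin 2 b (tbin 2 c c)) => f n; rewrite !nandP Eb Ec.
  by split=> [|h]; [tauto | move=> hb; apply: contrapT; tauto].
Qed.

Lemma model_qfac10 : qfac10 model.
Proof.
move=> A ex; have [t Et] := qf_term A.
(* The witness searches for a zero of the characteristic function of [A] supplied by [qf_term]. *)
exists (of_term (tat0 (tcomp (TPhi_of (inl 3)) (tcomp (TK One Zero) t)))) => f.
apply/Et; rewrite /= PhiE /=; case: pselect => [e|[]]; first by case: cid.
by have [n /Et] := ex f; exists n.
Qed.

(** * Elementarity of the type-one part and correctness of [S_k] *)

Lemma seq_term (l : seq (el model One)) :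
  exists t : term (Arr Zero One), forall d i, i < size l ->
    ev0 t i = @val One (nth d l i).
Proof.
elim: l => [|f l [t Et]]; first by exists (TK Zero Zero).
have [u Eu] := val_denoted One f; exists (tcons u t) => d [|i] // /Et.
exact.
Qed.

(** All parameters are packed into one sequence term; a Skolem function applied to it picks a
    witness, which is therefore denoted. *)
Lemma witness_term (f : el model One) (gs : seq (el model One)) k b h :
  witness (@val One f) [seq @val One g | g <- gs] k b h ->
  exists g : el model One,
    witness (@val One f) [seq @val One g | g <- gs] k b (@val One g).
Proof.
move=> wh; have [t Et] := seq_term (f :: gs).
exists (@of_term One (TApp (TPhi_of (inr (k, size gs, b))) t)).
rewrite val_of_term /= PhiE /=.
have -> : ev0 t 0 = @val One f by rewrite (Et f).
have -> : [seq ev0 t i.+1 | i <- iota 0 (size gs)] = [seq @val One g | g <- gs].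
  apply: (@eq_from_nth _ id); rewrite !size_map size_iota // => i il.
  rewrite (nth_map 0) ?size_iota // nth_iota // add0n (nth_map f) //.
  by rewrite (Et f).
exact: pick_fnP wh.
Qed.

(* Tarski-Vaught: the type-one part is closed under Skolem functions, hence
   second-order elementary in the full structure. *)
Lemma nf_full (f : el model One) k ex gs :
  nf model f k ex gs <-> full_nf (@val One f) k ex [seq @val One g | g <- gs].
Proof.
elim: k ex gs => [|k IH] ex gs.
  have E n : flatten [seq bar model g n | g <- gs] =
      flatten [seq [seq g i | i <- iota 0 n] | g <- [seq @val One g | g <- gs]].
    by rewrite -map_comp.
  case: ex => /=; split.
  - by move=> [n h]; exists n; rewrite -E.
  - by move=> [n h]; exists n; rewrite E.
  - by move=> h n; rewrite -E; apply: h.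
  - by move=> h n; rewrite E; apply: h.
case: ex => /=; split.
- by move=> [g /IH]; rewrite map_rcons; exists (@val One g).
- move=> [h wh]; have [g wg] := witness_term f gs k true h wh.
  by exists g; apply/IH; rewrite map_rcons.
(* A counterexample in the full structure would yield one in the model. *)
- move=> all h; apply: contrapT => nh.
  have [g] := witness_term f gs k false h nh; apply.
  by rewrite -map_rcons; apply/IH.
- by move=> all g; apply/IH; rewrite map_rcons.
Qed.

Lemma model_Sk k : has_Sk model k.
Proof.
exists (of_term (tat0 (tcomp (TPhi_of (inl k.+4)) (TK One Zero)))).
split=> f /=; rewrite PhiE /=; first by case: asboolP.
rewrite /sigma1k nf_full /=.
by case: asboolP.
Qed.

Lemma model_Z2w : Z2w model.
Proof.
split; last by move=> k _; apply: model_Sk.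
split; first exact: model_succ.
split; first exact: model_Pi.
split; first exact: model_Sigma.
split; first exact: model_Rec.
split; first exact: model_ext.
exact: model_qfac10.
Qed.

Lemma model_not_PITo :
  (forall n m, x n m <= 1) -> (forall n, (H (x n)).1 = n) ->
  (forall u v : term One, let f := ev0 u in let g := ev0 v in
     (forall i, i < (H f).2 -> g i = f i) -> (H g).1 <= (H f).2) ->
  ~ PITo model.
Proof.
move=> x01 Fx loc /(_ (of_term TF) (of_term TG))[N bd].
(* At the binary function [x_(N+1)] the value of [F] is [N + 1], which exceeds the proposed bound
   [N]. *)
have xC : inC model (@of_term One (TX N.+1)) by move=> i; apply: x01.
suff L : LOC model (of_term TF) (of_term TG).
  by have := bd L _ xC; rewrite /= Fx ltnn.
move=> f g _ _; have [u Eu] := val_denoted One f; have [v Ev] := val_denoted One g.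
move=> cyl; have := loc u v; rewrite /= Eu Ev; apply=> i; exact: cyl.
Qed.

End TermModel.

Theorem theorem4p9 : exists M : tstruct, Z2w M /\ ~ PITo M.
Proof.
have [x [H [x01 Fx loc]]] := generic_oracle Phi.
by exists (model x H); split; [apply: model_Z2w | apply: model_not_PITo].
Qed.
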